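(* The idempotent probability measure functor $I$, acting in the category of compact Hausdorff spaces and continuous maps, is open.
   Context: For a compact Hausdorff space $X$, $C(X)$ is the Banach space of continuous real-valued functions on $X$ with the sup-norm; $c_X\in C(X)$ is the constant function with value $c\in\mathbb R$; $c\odot\varphi=c_X+\varphi$ for $c\in\mathbb R$, $\varphi\in C(X)$, and $\varphi\oplus\psi=\max\{\varphi,\psi\}$ (pointwise); for real numbers $a\odot b=a+b$, $a\oplus b=\max\{a,b\}$. An idempotent probability measure on $X$ is a functional $\mu\colon C(X)\to\mathbb R$ such that $\mu(c_X)=c$, $\mu(c\odot\varphi)=c\odot\mu(\varphi)$ and $\mu(\varphi\oplus\psi)=\mu(\varphi)\oplus\mu(\psi)$ for all $c\in\mathbb R$, $\varphi,\psi\in C(X)$. $I(X)$ is the set of all idempotent probability measures on $X$ with the weak* topology, whose base consists of the sets $\{\nu\in I(X)\mid |\mu(\varphi_i)-\nu(\varphi_i)|<\varepsilon,\ i=1,\dots,n\}$, where $\mu\in I(X)$, $\varphi_1,\dots,\varphi_n\in C(X)$, $\varepsilon>0$; the space $I(X)$ is compact Hausdorff. For a continuous map $f\colon X\to Y$ of compact Hausdorff spaces, $I(f)\colon I(X)\to I(Y)$ is defined by $I(f)(\mu)(\varphi)=\mu(\varphi\circ f)$, $\varphi\in C(Y)$. This makes $I$ a covariant endofunctor of the category of compact Hausdorff spaces and continuous maps. A map of topological spaces is open if the image of every open set is open. A covariant endofunctor $F$ of the category of compact Hausdorff spaces is called open if it preserves the class of open surjective maps, i.e. $F(f)$ is an open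 surjective map whenever $f$ is an open surjective continuous map of compact Hausdorff spaces. *)

(* Defs.v *)
From HB Require Import structures.
From mathcomp Require Import all_boot all_order all_algebra.
From mathcomp Require Import all_classical all_reals all_analysis.

Set Implicit Arguments.
Unset Strict Implicit.
Unset Printing Implicit Defensive.

Import Order.TTheory GRing.Theory Num.Theory.
Import numFieldNormedType.Exports.

Local Open Scope classical_set_scope.
Local Open Scope ring_scope.

(* Spaces are not assumed to be nonempty. *)
Record compHaus := CompHaus {
  compHaus_sort :> topologicalType;
  compHaus_compact : compact [set: compHaus_sort];
  compHaus_hausdorff : hausdorff_space compHaus_sort }.

Record endofunctor := Endofunctor {
  functor_obj :> compHaus -> compHaus;
  functor_map : forall X Y : compHaus,
    continuousType X Y -> continuousType (functor_obj X) (functor_obj Y);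
  functor_id : forall X : compHaus,
    functor_map (idfun : continuousType X X) = (idfun : continuousType (functor_obj X) (functor_obj X));
  functor_comp : forall (X Y Z : compHaus)
      (f : continuousType X Y) (g : continuousType Y Z),
    functor_map (g \o f : continuousType X Z) =
    (functor_map g \o functor_map f : continuousType (functor_obj X) (functor_obj Z)) }.

Definition open_map (X Y : topologicalType) (f : X -> Y) : Prop :=
  forall U : set X, open U -> open (f @` U).

Definition open_functor (F : endofunctor) : Prop :=
  forall (X Y : compHaus) (f : continuousType X Y),
    open_map f -> set_surj [set: X] [set: Y] f ->
    open_map (functor_map F f) /\ set_surj [set: F X] [set: F Y] (functor_map F f).

Section continuous_operations.
Context {R : realType} {X : topologicalType}.

Lemma cts_funD (f g : continuousType X R) : continuous (f \+ g).
Proof. by move=> x; apply: (@continuousD R R^o) => ?; exact: cts_fun. Qed.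

HB.instance Definition _ (f g : continuousType X R) :=
  @isContinuous.Build X R (f \+ g) (@cts_funD f g).

Lemma cts_fun_max (f g : continuousType X R) : continuous (f \max g).
Proof. by move=> x; apply: continuous_max => ?; exact: cts_fun. Qed.

HB.instance Definition _ (f g : continuousType X R) :=
  @isContinuous.Build X R (f \max g) (@cts_fun_max f g).

End continuous_operations.

Section idempotent_measures.
Context (R : realType).
Local Notation "'C' X" := (continuousType X R) (at level 10, X at level 9).

Definition odot (X : topologicalType) (c : R) (phi : C X) : C X := cst c \+ phi.

Definition oplus (X : topologicalType) (phi psi : C X) : C X := phi \max psi.

Definition idempotent_probability (X : topologicalType) :
    set {ptws C X -> R} :=
  [set mu : C X -> R |
    [/\ forall c : R, mu (cst c) = c,
        forall (c : R) (phi : C X), mu (odot c phi) = c + mu phi &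
        forall phi psi : C X,
          mu (oplus phi psi) = Num.max (mu phi) (mu psi)]].

(* The subtype topology inherited from pointwise convergence on C(X) -> R is
   the weak* topology; see nbhs_idemE for the usual base. *)
Definition idem_space (X : topologicalType) : topologicalType :=
  set_type (@idempotent_probability X).

Definition idem_eval {X : topologicalType} (mu : idem_space X) : C X -> R :=
  set_val mu.

Lemma idem_evalP (X : topologicalType) (mu : idem_space X) :
  idempotent_probability (idem_eval mu).
Proof. exact: set_valP. Qed.

Lemma idem_eqP (X : topologicalType) (mu nu : idem_space X) :
  idem_eval mu =1 idem_eval nu -> mu = nu.
Proof. by move=> /funext e; apply: val_inj. Qed.

Lemma idem_eval_continuous {X : topologicalType} (phi : C X) :
  continuous (fun mu : idem_space X => idem_eval mu phi).
Proof.
move=> mu.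
apply: (@continuous_comp _ {ptws C X -> R} _ set_val
  (fun h => h phi)).
  exact: initial_continuous.
exact: (@proj_continuous (C X) (fun=> R) phi).
Qed.

Lemma idem_cvgP (X : topologicalType) (F : set_system (idem_space X))
    (mu : idem_space X) : Filter F ->
  (F --> mu) <->
  forall phi, idem_eval^~ phi @ F --> idem_eval mu phi.
Proof.
move=> FF; split=> [Fmu phi|Fmu].
  exact: (cvg_trans (cvg_app _ Fmu) (@idem_eval_continuous X phi mu)).
have cF : {ptws, idem_eval @ F --> idem_eval mu}.
  apply/cvg_sup => phi A [B [[W oW <-] Wmu] sWA]; rewrite nbhs_filterE.
  by apply: filterS sWA _; apply: (Fmu phi); exact: open_nbhs_nbhs.
move=> A [B [[W oW <-] Wmu] sWA]; rewrite nbhs_filterE.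
by apply: filterS sWA _; apply: cF; exact: open_nbhs_nbhs.
Qed.

Lemma nbhs_idemE (X : topologicalType) (mu : idem_space X)
    (A : set (idem_space X)) :
  nbhs mu A <-> exists (n : nat) (phi : 'I_n -> C X) (e : R), 0 < e /\
    [set nu | forall i, `|idem_eval mu (phi i) - idem_eval nu (phi i)| < e]
      `<=` A.
Proof.
pose B (s : {n & 'I_n -> C X} * R) := [set nu : idem_space X |
  forall i, `|idem_eval mu (tagged s.1 i) - idem_eval nu (tagged s.1 i)| < s.2].
have FF : Filter (filter_from [set s | 0 < s.2] B).
  apply: filter_from_filter.
    have phi0 : 'I_0 -> C X by case.
    by exists (Tagged (fun n => 'I_n -> C X) phi0, 1) => /=.
  move=> [[n1 p1] e1] [[n2 p2] e2] /= e10 e20.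
  pose p (i : 'I_(n1 + n2)) := match fintype.split i with inl j => p1 j | inr j => p2 j end.
  exists (Tagged (fun n => 'I_n -> C X) p, Num.min e1 e2) => /=.
    by rewrite lt_min e10.
  move=> nu /= nup; split=> /= i.
    have := nup (lshift n2 i).
    rewrite /= /p (unsplitK (inl i : 'I_n1 + 'I_n2)) lt_min.
    by case/andP.
  have := nup (rshift n1 i).
  rewrite /= /p (unsplitK (inr i : 'I_n1 + 'I_n2)) lt_min.
  by case/andP.
split=> [|[n [phi [e [e0 sA]]]]].
  suff Fmu : filter_from [set s | 0 < s.2] B --> mu.
    move=> /Fmu [[[n phi] e] /= e0 sA]; by exists n, phi, e.
  apply/idem_cvgP => phi; apply/cvgrPdist_lt => e e0.
  exists (Tagged (fun n => 'I_n -> C X) (fun _ : 'I_1 => phi), e) => //.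
  by move=> nu /= /(_ ord0).
apply: (filterS sA).
apply: (@filter_forall _ _ (fun i nu =>
  `|idem_eval mu (phi i) - idem_eval nu (phi i)| < e) _ (nbhs_filter mu)) => i.
have /cvgrPdist_lt := @idem_eval_continuous X (phi i) mu.
exact.
Qed.

Lemma idem_hausdorff (X : topologicalType) : hausdorff_space (idem_space X).
Proof.
move=> mu nu cl; apply: idem_eqP => phi; apply: (@Rhausdorff R).
move=> A B nA nB.
have [] := cl (idem_eval^~ phi @^-1` A) (idem_eval^~ phi @^-1` B).
- exact: idem_eval_continuous.
- exact: idem_eval_continuous.
by move=> xi [Axi Bxi]; exists (idem_eval xi phi).
Qed.

Lemma idem_homo (X : topologicalType) (mu : idem_space X) (phi psi : C X) :
  (forall x, phi x <= psi x) -> idem_eval mu phi <= idem_eval mu psi.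
Proof.
move=> le; have [_ _ /(_ phi psi)] := idem_evalP mu.
rewrite (_ : oplus phi psi = psi).
  by move=> ->; rewrite le_max lexx.
by apply/continuousEP => x /=; apply/max_idPr.
Qed.

Lemma idem_bounded (X : topologicalType) (phi : C X) :
  compact [set: X] ->
  exists M, forall mu : idem_space X, idem_eval mu phi \in `[- M, M].
Proof.
move=> cX; have [M phiM] : exists M, forall x, `|phi x| <= M.
  have : compact (phi @` [set: X]).
    by apply: continuous_compact => //; apply: continuous_subspaceT; exact: cts_fun.
  move=> /(@compact_bounded R R^o) [M [_ /(_ (M + 1))]].
  rewrite ltrDl => /(_ ltr01) h.
  by exists (M + 1) => x; apply: h; exists x.
exists M => mu; have [mu1 _ _] := idem_evalP mu.
rewrite in_itv /=; apply/andP; split; [rewrite -[leLHS]mu1|rewrite -[leRHS]mu1];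
  by apply: idem_homo => x /=; have := phiM x; rewrite ler_norml => /andP[].
Qed.

Lemma idem_closed (X : topologicalType) : closed (@idempotent_probability X).
Proof.
have ev phi : continuous (fun mu : {ptws C X -> R} => mu phi).
  exact: (@proj_continuous (C X) (fun=> R) phi).
have closed_equ (u v : {ptws C X -> R} -> R) : continuous u -> continuous v ->
    closed [set mu | u mu = v mu].
  move=> cu cv; rewrite (_ : mkset _ = (fun mu => u mu - v mu) @^-1` [set 0]).
    apply: preimage_closed => [mu _|]; last exact: closed_eq.
    by apply: (@continuousB R R^o); [exact: cu|exact: cv].
  by apply/seteqP; split=> mu /=; [move=> ->; rewrite subrr|move/eqP; rewrite subr_eq0 => /eqP].
rewrite (_ : @idempotent_probability X =
  \bigcap_(c : R) [set mu : {ptws C X -> R} | mu (cst c) = c] `&`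
  \bigcap_(s : R * C X)
    [set mu : {ptws C X -> R} | mu (odot s.1 s.2) = s.1 + mu s.2] `&`
  \bigcap_(s : C X * C X)
    [set mu : {ptws C X -> R} |
      mu (oplus s.1 s.2) = Num.max (mu s.1) (mu s.2)]).
  apply: closedI; first apply: closedI; apply: closed_bigI => s _.
  - apply: (closed_equ (fun mu => mu (cst s)) (fun=> s)); first exact: ev.
    exact: (@cts_fun _ _ (cst s : continuousType {ptws C X -> R} R)).
  - apply: (closed_equ (fun mu => mu (odot s.1 s.2))
      (fun mu => s.1 + mu s.2)); first exact: ev.
    move=> mu; apply: (@continuousD R R^o {ptws C X -> R} (cst s.1)
      (fun mu => mu s.2)); last exact: ev.
    exact: (@cts_fun _ _ (cst s.1 : continuousType {ptws C X -> R} R)).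
  - apply: (closed_equ (fun mu => mu (oplus s.1 s.2))
      (fun mu => Num.max (mu s.1) (mu s.2))); first exact: ev.
    move=> mu; apply: (@continuous_max R {ptws C X -> R} (fun mu => mu s.1)
      (fun mu => mu s.2)); exact: ev.
apply/seteqP; split=> mu /=.
  by move=> [h1 h2 h3]; split; [split|] => s _ /=.
move=> [[h1 h2] h3]; split=> [c|c phi|phi psi].
- exact: h1.
- exact: (h2 (c, phi)).
- exact: (h3 (phi, psi)).
Qed.

Lemma idem_compact (X : topologicalType) :
  compact [set: X] -> compact [set: idem_space X].
Proof.
move=> cX; have /choice[M bM] := fun phi : C X => idem_bounded phi cX.
have cK : compact [set h : {ptws C X -> R} |
    forall phi, [set` `[- M phi, M phi]] (h phi)].
  apply: (@tychonoff _ (fun=> R) (fun phi => [set` `[- M phi, M phi]])) => phi.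
  exact: segment_compact.
have cI : compact (@idempotent_probability X).
  apply: (subclosed_compact _ cK); first exact: idem_closed.
  by move=> mu /mem_set mup phi; exact: (bM phi (exist _ mu mup)).
move=> F FF _.
have [|h [hp clh]] := cI (idem_eval @ F).
  by apply: nearW => mu; exact: idem_evalP.
exists (exist _ h (mem_set hp)); split=> // A B FA [_ [[W oW <-] Wh] sWB].
have FA' : (idem_eval @ F) (idem_eval @` A).
  by apply: (@filterS _ F _ A) => // mu Amu; exists mu.
have [_ [[mu Amu <-] Wmu]] := clh _ W FA' (open_nbhs_nbhs (conj oW Wh)).
by exists mu; split=> //; exact: sWB.
Qed.

Section map.
Context (X Y : topologicalType) (f : continuousType X Y).

Definition idem_push (mu : C X -> R) : C Y -> R :=
  fun phi => mu (phi \o f : C X).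

Lemma idem_push_idem (mu : idem_space X) :
  idem_push (idem_eval mu) \in @idempotent_probability Y.
Proof.
have [mu1 mu2 mu3] := idem_evalP mu; apply/mem_set.
split=> [c|c phi|phi psi]; rewrite /idem_push.
- by rewrite -[RHS]mu1; congr idem_eval; exact/continuousEP.
- by rewrite -mu2; congr idem_eval; exact/continuousEP.
- by rewrite -mu3; congr idem_eval; exact/continuousEP.
Qed.

Definition idem_map (mu : idem_space X) : idem_space Y :=
  exist _ (idem_push (idem_eval mu)) (idem_push_idem mu).

Lemma idem_mapE (mu : idem_space X) (phi : C Y) :
  idem_eval (idem_map mu) phi = idem_eval mu (phi \o f : C X).
Proof. by []. Qed.

Lemma idem_map_continuous : continuous idem_map.
Proof.
move=> mu; have FF : Filter (idem_map @ mu).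
  exact/fmap_filter/nbhs_filter.
apply/idem_cvgP => phi; exact: (@idem_eval_continuous X (phi \o f : C X) mu).
Qed.

HB.instance Definition _ :=
  @isContinuous.Build (idem_space X) (idem_space Y) idem_map
    idem_map_continuous.

End map.

Definition idem_compHaus (X : compHaus) : compHaus :=
  CompHaus (idem_compact (@compHaus_compact X)) (@idem_hausdorff X).

Lemma idem_map_id (X : compHaus) :
  (idem_map (idfun : continuousType X X) :
     continuousType (idem_space X) (idem_space X)) = idfun.
Proof.
apply/continuousEP => mu; apply: idem_eqP => phi; rewrite idem_mapE /=.
by congr idem_eval; exact/continuousEP.
Qed.

Lemma idem_map_comp (X Y Z : compHaus)
    (f : continuousType X Y) (g : continuousType Y Z) :
  (idem_map (g \o f : continuousType X Z) :
     continuousType (idem_space X) (idem_space Z)) =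
  (idem_map g \o idem_map f).
Proof.
apply/continuousEP => mu; apply: idem_eqP => phi; rewrite idem_mapE /=.
by congr idem_eval; exact/continuousEP.
Qed.

Definition idem_functor : endofunctor :=
  @Endofunctor idem_compHaus (fun X Y f => idem_map f)
    idem_map_id idem_map_comp.

End idempotent_measures.

(* Main.v *)
Require Import Defs.
From HB Require Import structures.
From mathcomp Require Import all_boot all_order all_algebra.
From mathcomp Require Import all_classical all_reals all_analysis.
From mathcomp Require Import lra.

(** Let f : X -> Y be an open surjection.  Maximising over the fibres of f
sends phi in C(X) to a function [fibre_max phi] on Y, which is continuous
because f is both open and closed.  This operation commutes with maxima and
with adding functions lifted from Y, so for every weight g <= 0 on X whose
maximum on each fibre is 0 the functional
  phi |-> nu (fibre_max (phi + g))
is an idempotent measure on X that I(f) maps to nu ([idem_liftK]).  With g = 0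
this gives surjectivity.  For fixed g it is moreover a section of I(f) that
depends continuously on nu, so I(f) is open as soon as, for every mu in I(X),
the values at I(f)(mu) of these sections come arbitrarily close to mu.  That
approximation is [exists_fibre_weight].

To find g, think of mu as the supremum of the Dirac measures at x shifted by
a density l(x) <= 0, and of nu = I(f)(mu) in the same way with density l'(y),
the maximum of l over the fibre of y.  The measure lifted with weight g has
density l'(f x) + g(x).  It must be essentially at most l, as seen by the
finitely many test functions phi i, and nearly equal to l at points x i where
mu (phi i) is attained.  Put Phi = max_i (phi i - mu (phi i)), so that
l <= - Phi, with equality at each x i.  The weight
  g = min (0, kappa o f - Phi)
works when - kappa is a continuous function on Y which dominates l', almost
equals l' at the points f (x i), and is at most the fibre maximum of - Phi.
The first requirement reads nu kappa <= 0, the last makes the fibre maximum of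
g vanish, and the middle one is met since l' is an infimum of continuous
functions.  Densities do not appear in the formal proof:
the points x i come from [exists_supporting], and the continuous functions
that approximate l' at a point from [exists_near_density]. *)

Set Implicit Arguments.
Unset Strict Implicit.
Unset Printing Implicit Defensive.

Import Order.TTheory GRing.Theory Num.Theory.
Import numFieldNormedType.Exports.

Local Open Scope classical_set_scope.
Local Open Scope ring_scope.

(** * Opposites of continuous functions *)

Section continuous_opposite.
Context {R : realType} {X : topologicalType}.

Lemma cts_funN (f : continuousType X R) : continuous (\- f).
Proof. by move=> x; apply: (@continuousN R R^o); exact: cts_fun. Qed.

HB.instance Definition _ (f : continuousType X R) :=
  @isContinuous.Build X R (\- f) (@cts_funN f).

End continuous_opposite.

(** * Support points and densities of an idempotent measure *)

Section functional_bounds.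
Context {R : realType} {X : topologicalType}.
Implicit Types (mu : idem_space R X) (phi psi : continuousType X R).

Lemma idem_cst mu (c : R) : idem_eval mu (cst c) = c.
Proof. by have [] := idem_evalP mu. Qed.

Lemma idem_odot mu (c : R) phi : idem_eval mu (odot c phi) = c + idem_eval mu phi.
Proof. by have [] := idem_evalP mu. Qed.

Lemma idem_oplus mu phi psi :
  idem_eval mu (oplus phi psi) = Num.max (idem_eval mu phi) (idem_eval mu psi).
Proof. by have [] := idem_evalP mu. Qed.

(** Writing mu psi as the maximum over z of psi z + l z for a density l, this
says that the maximum defining mu phi is attained at x.  The form without l is
that of a subgradient: the Dirac measure at x, shifted to agree with mu at phi,
is at most mu. *)
Definition supporting mu phi (x : X) : Prop :=
  forall psi, psi x + idem_eval mu phi <= phi x + idem_eval mu psi.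

(** The closed sets where psi <= phi, for psi with mu psi < mu phi, are nonempty
by monotonicity, and directed because max (psi1, psi2) is again such a psi.  By
compactness they have a common point, and shifting psi by constants turns
membership in all of them into the supporting inequality. *)
Lemma exists_supporting mu phi :
  compact [set: X] -> exists x, supporting mu phi x.
Proof.
move=> cX.
pose D := [set psi | idem_eval mu psi < idem_eval mu phi].
pose A psi := [set x | psi x <= phi x].
have FF : ProperFilter (filter_from D A).
  apply: filter_from_proper.
    apply: filter_from_filter.
      by exists (odot (-1) phi); rewrite /D /= idem_odot; lra.
    move=> psi1 psi2; rewrite /D /= => D1 D2.
    exists (oplus psi1 psi2); first by rewrite /= idem_oplus gt_max D1.
    by move=> x; rewrite /A /= ge_max => /andP[].
  move=> psi Dpsi; apply: contrapT => Apsi.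
  suff : idem_eval mu phi <= idem_eval mu psi by rewrite leNgt Dpsi.
  apply: idem_homo => x; rewrite leNgt; apply/negP => lt.
  by apply: Apsi; exists x; exact: ltW.
have [|x [_ clx]] := cX _ FF; first exact: filterT.
have Ax psi : D psi -> psi x <= phi x.
  move=> Dpsi; rewrite leNgt; apply/negP => lt.
  have nV : nbhs x [set z | 0 < psi z - phi z].
    have cd : continuous ((psi : X -> R) \+ (\- phi : X -> R)).
      exact: (@cts_fun _ _ (psi \+ (\- phi : continuousType X R) : continuousType X R)).
    apply: (cd x [set r | 0 < r]).
    by apply: open_nbhs_nbhs; split; [exact: open_gt|rewrite /= subr_gt0].
  have [|z []] := clx (A psi) _ _ nV; first by exists psi.
  by rewrite /A /=; lra.
(* This shift puts psi just inside D. *)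
exists x => psi; apply/ler_addgt0Pr => e e0.
have := Ax (odot (idem_eval mu phi - idem_eval mu psi - e) psi).
rewrite /D /= idem_odot => h.
have : idem_eval mu phi - idem_eval mu psi - e + psi x <= phi x by apply: h; lra.
lra.
Qed.

(** The density of mu at x is the infimum of mu psi - psi x over all psi.  When
it is finite, bounded below by c, an e-optimal psi shifted to have mu psi = 0
approximates the density at x by - psi x. *)
Lemma exists_near_density mu (x : X) (c e : R) : 0 < e ->
  (forall psi : continuousType X R, psi x + c <= idem_eval mu psi) ->
  exists2 psi, idem_eval mu psi = 0 &
    forall chi : continuousType X R, chi x <= idem_eval mu chi + psi x + e.
Proof.
move=> e0 lbc; pose E := [set idem_eval mu psi - psi x | psi in setT].
have lbE : lbound E c by move=> _ [psi _ <-]; have := lbc psi; lra.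
have infE : has_inf E by split; [exists (idem_eval mu (cst 0) - 0), (cst 0)|exists c].
have [_ [psi _ <-] lt] := inf_adherent e0 infE.
exists (odot (- idem_eval mu psi) psi); first by rewrite idem_odot addNr.
move=> chi /=.
have : inf E <= idem_eval mu chi - chi x by apply: ge_inf; [exists c|exists chi].
lra.
Qed.

Lemma le_bigoplus n (psi0 : continuousType X R) (F : 'I_n -> continuousType X R) x :
  psi0 x <= (\big[@oplus R X/psi0]_i F i) x /\
  forall i, F i x <= (\big[@oplus R X/psi0]_i F i) x.
Proof.
elim: n F => [|n IH] F; first by rewrite big_ord0; split=> // -[].
rewrite big_ord_recl; have [IH0 IHS] := IH (fun i => F (lift ord0 i)).
split=> [|i]; first by rewrite /= le_max IH0 orbT.
rewrite /= le_max; have [j ->|->] := unliftP ord0 i; last by rewrite lexx.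
by rewrite IHS orbT.
Qed.

End functional_bounds.

(** * Maxima over the fibres of an open surjection *)

Section fibre_maximum.
Context {R : realType} {X Y : compHaus} (f : continuousType X Y).
Context (f_open : open_map f) (f_surj : set_surj [set: X] [set: Y] f).
Implicit Types (phi psi g : continuousType X R).

(** The superlevel set of h at r is the image of that of phi.  Strict superlevel
sets are thus open since f is open, and non-strict ones closed since f is closed by
compactness of X. *)
Lemma exists_fibre_max phi : exists h : continuousType Y R,
  (forall x, phi x <= h (f x)) /\ (forall y, exists2 x, f x = y & h y = phi x).
Proof.
have /choice[h hP] y : exists r,
    (forall x, f x = y -> phi x <= r) /\ exists2 x, f x = y & r = phi x.
  have fy0 : (f @^-1` [set y]) !=set0 by have [x _ <-] := f_surj (I : setT y); exists x.
  have cfy : compact (f @^-1` [set y]).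
    apply: (subclosed_compact _ (@compHaus_compact X)) => //.
    apply: preimage_closed => [x _|]; first exact: cts_fun.
    by apply: compact_closed; [exact: compHaus_hausdorff|exact: compact_set1].
  have [|x fx mx] := @compact_EVT_max X R phi _ fy0 cfy.
    by apply: continuous_subspaceT; exact: cts_fun.
  exists (phi x); split; last by exists x; [exact: set_mem|].
  by move=> x' fx'; apply: mx; exact: mem_set.
have hx x : phi x <= h (f x) by apply: (hP (f x)).1.
have hc : continuous h.
  move=> y; apply/cvgrPdist_lt => e e0.
  have o1 : open (f @` (phi @^-1` [set r | h y - e < r])).
    by apply/f_open/open_comp; [move=> ? _; exact: cts_fun|exact: open_gt].
  have c2 : closed (f @` (phi @^-1` [set r | h y + e <= r])).
    apply: compact_closed; first exact: compHaus_hausdorff.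
    apply: continuous_compact.
      by apply: continuous_subspaceT; exact: cts_fun.
    apply: (subclosed_compact _ (@compHaus_compact X)) => //.
    by apply: preimage_closed; [move=> ? _; exact: cts_fun|exact: closed_ge].
  have n1 : nbhs y (f @` (phi @^-1` [set r | h y - e < r])).
    apply: open_nbhs_nbhs; split => //.
    have [_ [x <- hE]] := hP y; exists x => //=; rewrite -hE; lra.
  have n2 : nbhs y (~` (f @` (phi @^-1` [set r | h y + e <= r]))).
    apply: open_nbhs_nbhs; split; first exact: closed_openC.
    by move=> [x /= le fx]; have := hx x; rewrite fx; lra.
  near=> z.
  have [x /= lt1 fx] : (f @` (phi @^-1` [set r | h y - e < r])) z by near: z.
  have hz1 : h y - e < h z by apply: (lt_le_trans lt1); rewrite -fx.
  have nz : (~` (f @` (phi @^-1` [set r | h y + e <= r]))) z by near: z.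
  have hz2 : h z < h y + e.
    rewrite ltNge; apply/negP => le; apply: nz.
    by have [_ [x' fx' hE]] := hP z; exists x' => //=; rewrite -hE.
  by rewrite ltr_norml; apply/andP; split; lra.
exists (mkcts hc); split=> [//|y]; exact: (hP y).2.
Unshelve. all: by end_near.
Qed.

Definition fibre_max phi : continuousType Y R := sval (cid (exists_fibre_max phi)).

Lemma le_fibre_max phi x : phi x <= fibre_max phi (f x).
Proof. exact: (svalP (cid (exists_fibre_max phi))).1. Qed.

Lemma fibre_max_attained phi y : exists2 x, f x = y & fibre_max phi y = phi x.
Proof. exact: (svalP (cid (exists_fibre_max phi))).2. Qed.

Lemma fibre_max_le phi y c :
  (forall x, f x = y -> phi x <= c) -> fibre_max phi y <= c.
Proof. by move=> le; have [x fx ->] := fibre_max_attained phi y; exact: le. Qed.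

Lemma fibre_maxD (psi : continuousType Y R) g :
  fibre_max ((psi \o f : continuousType X R) \+ g) = psi \+ fibre_max g.
Proof.
apply/continuousEP => y; apply/eqP; rewrite eq_le; apply/andP; split.
  by apply: fibre_max_le => x <- /=; rewrite lerD2l; exact: le_fibre_max.
have [x <- /= ->] := fibre_max_attained g y.
exact: (le_fibre_max ((psi \o f : continuousType X R) \+ g)).
Qed.

Lemma fibre_max_odot c phi : fibre_max (odot c phi) = odot c (fibre_max phi).
Proof.
by rewrite /odot -fibre_maxD; congr fibre_max; exact/continuousEP.
Qed.

Lemma fibre_max_oplus phi psi :
  fibre_max (oplus phi psi) = oplus (fibre_max phi) (fibre_max psi).
Proof.
apply/continuousEP => y; apply/eqP; rewrite eq_le; apply/andP; split.
  apply: fibre_max_le => x <- /=; rewrite ge_max !le_max !le_fibre_max.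
  by rewrite orbT.
rewrite /= ge_max; apply/andP; split; apply: fibre_max_le => x <-;
  by apply: le_trans (le_fibre_max _ x); rewrite /= le_max lexx ?orbT.
Qed.

(** * Sections of the push-forward *)

Section lift.
Context (g : continuousType X R) (g0 : fibre_max g = cst 0).

Definition lift_functional (nu : continuousType Y R -> R) :
  continuousType X R -> R := fun phi => nu (fibre_max (phi \+ g)).

Lemma lift_functional_idem (nu : idem_space R Y) :
  lift_functional (idem_eval nu) \in @idempotent_probability R X.
Proof.
apply/mem_set; split=> [c|c phi|phi psi]; rewrite /lift_functional.
- have -> : cst c \+ g = odot c g :> continuousType X R by exact/continuousEP.
  by rewrite fibre_max_odot g0 idem_odot idem_cst addr0.
- rewrite -idem_odot -fibre_max_odot; congr (idem_eval _ (fibre_max _)).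
  by apply/continuousEP => x /=; rewrite addrA.
- rewrite -idem_oplus -fibre_max_oplus; congr (idem_eval _ (fibre_max _)).
  by apply/continuousEP => x /=; rewrite addr_maxl.
Qed.

Definition idem_lift (nu : idem_space R Y) : idem_space R X :=
  exist _ (lift_functional (idem_eval nu)) (lift_functional_idem nu).

Lemma idem_liftE nu phi :
  idem_eval (idem_lift nu) phi = idem_eval nu (fibre_max (phi \+ g)).
Proof. by []. Qed.

Lemma idem_liftK : cancel idem_lift (idem_map f).
Proof.
move=> nu; apply: idem_eqP => psi; rewrite idem_mapE idem_liftE fibre_maxD g0.
by congr idem_eval; apply/continuousEP => y /=; rewrite addr0.
Qed.

End lift.

Lemma idem_map_surj : set_surj [set: idem_space R X] [set: idem_space R Y] (idem_map f).
Proof.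
have g0 : fibre_max (cst 0) = cst 0.
  apply/continuousEP => y.
  by have [x _ ->] := fibre_max_attained (cst 0) y.
by move=> nu _; exists (idem_lift g0 nu) => //; exact: idem_liftK.
Qed.

(** The sections [idem_lift] pass arbitrarily close to every mu.  The weight g
equals min (0, kappa o f - Phi).  The upper bound on the lifted measure uses
g <= kappa o f - Phi and nu kappa <= 0; the lower one evaluates at a point
supporting mu at phi i, whose image under f nearly carries the density of nu
that psi i records. *)
Lemma exists_fibre_weight (mu : idem_space R X) n
    (phi : 'I_n -> continuousType X R) (e : R) : 0 < e ->
  exists2 g, fibre_max g = cst 0 & forall i,
    `|idem_eval (idem_map f mu) (fibre_max (phi i \+ g)) - idem_eval mu (phi i)|
      <= e.
Proof.
move=> e0; set nu := idem_map f mu.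
pose a i := idem_eval mu (phi i).
pose Phi : continuousType X R :=
  \big[@oplus R X/(cst 0 : continuousType X R)]_i odot (- a i) (phi i).
have Phi_ge i x : phi i x - a i <= Phi x.
  rewrite addrC; exact: (le_bigoplus _ (fun i => odot (- a i) (phi i)) x).2.
have muPhi : idem_eval mu Phi <= 0.
  apply: (big_ind (fun u => idem_eval mu u <= 0)) => [|u v u0 v0|i _].
  - by rewrite idem_cst.
  - by rewrite idem_oplus ge_max u0.
  - by rewrite idem_odot addrC subrr.
have /choice[x xP] i := exists_supporting mu (phi i) (@compHaus_compact X).
(* The support property at x i bounds the density of nu at f (x i) below. *)
have /choice[psi psiP] i : exists psi : continuousType Y R,
    idem_eval nu psi = 0 /\
    forall chi : continuousType Y R, chi (f (x i)) <= idem_eval nu chi + psi (f (x i)) + e.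
  have [|psi] := @exists_near_density R Y nu (f (x i)) (a i - phi i (x i)) e e0.
    move=> psi; have := xP i (psi \o f : continuousType X R).
    by rewrite /nu idem_mapE /a /=; lra.
  by move=> psi0 le; exists psi.
(* Starting the maximum at low keeps - kappa below the fibre maximum of - Phi,
   so that some point of each fibre has weight 0. *)
pose low : continuousType Y R := \- fibre_max (\- Phi).
pose kappa : continuousType Y R := \big[@oplus R Y/low]_i psi i.
have kappa_low y : - fibre_max (\- Phi) y <= kappa y := (le_bigoplus low psi y).1.
have kappa_psi y i : psi i y <= kappa y := (le_bigoplus low psi y).2 i.
have nu_kappa : idem_eval nu kappa <= 0.
  apply: (big_ind (fun u => idem_eval nu u <= 0)) => [|u v u0 v0|i _].
  - rewrite /nu idem_mapE; apply: le_trans muPhi; apply: idem_homo => z /=.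
    by rewrite lerNl; exact: (le_fibre_max (\- Phi)).
  - by rewrite idem_oplus ge_max u0.
  - by rewrite (psiP i).1.
have [g gE] : exists g : continuousType X R,
    forall z, g z = - Num.max 0 (Phi z - kappa (f z)).
  by exists (\- oplus (cst 0) (Phi \+ (\- (kappa \o f : continuousType X R)))).
exists g.
  apply/continuousEP => y; apply/eqP; rewrite eq_le; apply/andP; split.
    by apply: fibre_max_le => z _; rewrite gE oppr_le0 le_max lexx.
  have [z fz hz] := fibre_max_attained (\- Phi) y.
  have := le_fibre_max g z; rewrite fz; apply: le_trans.
  rewrite gE oppr_ge0 ge_max lexx /= fz subr_le0.
  by have := kappa_low y; rewrite hz opprK.
move=> i; rewrite ler_norml; apply/andP; split; last first.
  suff : idem_eval nu (fibre_max (phi i \+ g)) <= a i + idem_eval nu kappa.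
    by rewrite /a; lra.
  rewrite -idem_odot; apply: idem_homo => y; apply: fibre_max_le => z <- /=.
  have : Phi z - kappa (f z) <= Num.max 0 (Phi z - kappa (f z)).
    by rewrite le_max lexx orbT.
  by have := Phi_ge i z; rewrite gE; lra.
have [psi0 psi_near] := psiP i.
have := psi_near (fibre_max (phi i \+ g)).
have := le_fibre_max (phi i \+ g) (x i).
(* The weight at x i loses no more than the gap that psi i leaves there. *)
have : Num.max 0 (Phi (x i) - kappa (f (x i))) <=
    phi i (x i) - a i - psi i (f (x i)).
  have := xP i (psi i \o f : continuousType X R).
  rewrite -idem_mapE -/nu psi0 /= => le1.
  have le2 := xP i Phi.
  have le3 := kappa_psi (f (x i)) i.
  by rewrite ge_max /a; apply/andP; split; lra.
by rewrite /= gE /a; lra.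
Qed.

(** Near I(f)(mu) the section chosen by [exists_fibre_weight] takes its values
in U, because only its values at the phi i matter and these are evaluations of
nu at the functions [fibre_max (phi i \+ g)]. *)
Lemma idem_map_open : open_map (@idem_map R X Y f).
Proof.
move=> U oU; rewrite openE => _ [mu Umu <-].
have /nbhs_idemE[n [phi [e [e0 sU]]]] : nbhs mu U by exact: open_nbhs_nbhs.
have e20 : 0 < e / 2 by lra.
have [g g0 gP] := exists_fibre_weight mu phi e20.
apply/nbhs_idemE; exists n, (fun i => fibre_max (phi i \+ g)), (e / 2).
split=> // nu nuP; exists (idem_lift g0 nu); last exact: idem_liftK.
apply: sU => i; rewrite idem_liftE; have := nuP i; have := gP i.
rewrite (distrC _ (idem_eval mu _)).
set r := idem_eval (idem_map f mu) _.
have := ler_distD r (idem_eval mu (phi i)) (idem_eval nu (fibre_max (phi i \+ g))).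
lra.
Qed.

End fibre_maximum.

Theorem theorem4p2 (R : realType) : open_functor (idem_functor R).
Proof.
move=> X Y f f_open f_surj; split; first exact: idem_map_open.
exact: idem_map_surj.
Qed.
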